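(* For any finite simple graph $X$ there is a finite group $G$ such that $\mathfrak{R}_G$ has $X$ as an induced subgraph (i.e. some induced subgraph of $\mathfrak{R}_G$ is isomorphic to $X$).
   Context: For a finite group $G$, let $\mathcal{N}_G$ be the simple graph whose vertices are the elements of $G$, with $x, y \in G$ joined by an edge if and only if the subgroup $\langle x, y\rangle$ is not nilpotent. The non-nilpotent graph $\mathfrak{R}_G$ is the graph obtained from $\mathcal{N}_G$ by removing all isolated vertices. *)

(* Defs.v *)
From HB Require Import structures.
From mathcomp Require Import all_boot all_fingroup all_solvable.

Set Implicit Arguments.
Unset Strict Implicit.
Unset Printing Implicit Defensive.

Local Open Scope group_scope.

(* The vertex type may be empty: the null graph is allowed. *)
Record sgraph := SGraph {
  vertex :> finType;
  adj : rel vertex;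
  adj_sym : symmetric adj;
  adj_irr : irreflexive adj
}.

Definition isolated (X : sgraph) (x : X) : bool := [forall y, ~~ adj x y].

Section Induced.
Variables (X : sgraph) (S : {set X}).

Definition induced_adj : rel {x : X | x \in S} := [rel x y | adj (val x) (val y)].

Lemma induced_adj_sym : symmetric induced_adj.
Proof. by move=> x y; apply: adj_sym. Qed.

Lemma induced_adj_irr : irreflexive induced_adj.
Proof. by move=> x; apply: adj_irr. Qed.

Definition induced : sgraph := SGraph induced_adj_sym induced_adj_irr.
End Induced.

Definition sgraph_iso (X Y : sgraph) : Prop :=
  exists2 f : X -> Y, bijective f & forall x y, adj (f x) (f y) = adj x y.

Definition has_induced_subgraph (Y X : sgraph) : Prop :=
  exists S : {set Y}, sgraph_iso (induced S) X.

Section NonNilpotent.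
Variables (gT : finGroupType) (G : {group gT}).

Definition nonnil_adj : rel [subg G] :=
  [rel x y | ~~ nilpotent <<[set sgval x; sgval y]>>].

Lemma nonnil_adj_sym : symmetric nonnil_adj.
Proof. by move=> x y; rewrite /nonnil_adj /= setUC. Qed.

Lemma nonnil_adj_irr : irreflexive nonnil_adj.
Proof.
move=> x; rewrite /nonnil_adj /= setUid; apply/negbF.
exact: abelian_nil (cycle_abelian _).
Qed.

Definition full_nonnil_graph : sgraph := SGraph nonnil_adj_sym nonnil_adj_irr.

Definition nonnil_graph : sgraph :=
  induced [set x : full_nonnil_graph | ~~ isolated x].
End NonNilpotent.

(* Main.v *)
Require Import Defs.
From HB Require Import structures.
From mathcomp Require Import all_boot all_fingroup all_solvable.

(** A single non-nilpotent group generated by two elements, here the symmetric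
    group of degree 3 generated by a transposition [tau] and a 3-cycle [rho], is
    enough to build any finite graph [X]: take one copy of it for every ordered
    pair [(a, b)] of vertices, and let the element attached to the vertex [u]
    have entry [tau] where [u = a], entry [rho] where [u = b] and [a], [b] are
    adjacent, and entry 1 in all other places.

    If [u] and [v] are adjacent, their elements project onto [tau] and [rho] in
    the copy [(u, v)], and a group with a non-nilpotent quotient is not nilpotent
    ([nonnil_coordinate]).  If they are distinct and not adjacent, then in
    every copy one of the two entries is 1, so that the elements commute and
    generate an abelian group ([vertex_elt_commute]).

    The copies [(u, u)] on the diagonal carry a nontrivial entry of the
    element of [u] and of no other vertex.  They make the
    elements pairwise distinct, and they keep even the isolated vertices
    of [X] in the graph, since every vertex element is joined to the constant
    family [rho] ([vertex_node_not_isolated]). *)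

Set Implicit Arguments.
Unset Strict Implicit.
Unset Printing Implicit Defensive.

Local Open Scope group_scope.

Lemma has_induced_subgraphI (X Y : sgraph) (h : X -> Y) :
    injective h -> (forall x y, adj (h x) (h y) = adj x y) ->
  has_induced_subgraph Y X.
Proof.
move=> h_inj h_adj; pose S := h @: [set: X].
have hS x : h x \in S by apply: imset_f; rewrite inE.
pose g x : induced S := Sub (h x) (hS x).
have g_inj : injective g by move=> x y /(congr1 val); apply: h_inj.
have [|f gK fK] := inj_card_bij g_inj.
  by rewrite card_sig (@eq_card _ _ (mem S)) // card_imset ?cardsT.
exists S, f; first by exists g.
by move=> x y; rewrite -{2}(fK x) -{2}(fK y) -h_adj.
Qed.

Lemma commute_nil (gT : finGroupType) (x y : gT) :
  commute x y -> nilpotent <<[set x; y]>>.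
Proof.
move=> cxy; apply: abelian_nil; rewrite abelian_gen.
apply/centsP=> a /set2P[]-> b /set2P[]-> //.
Qed.

(** The relation makes the cycle of [t] reproduce itself under commutation with
    the whole group, so that the lower central series never drops below it. *)
Lemma commg_fixed_nonnil (gT : finGroupType) (s t : gT) :
  t != 1 -> [~ t, s] = t -> ~~ nilpotent <<[set s; t]>>.
Proof.
move=> t_neq1 tsE; apply/negP=> /forall_inP/(_ <[t]>%G) nil_st.
have sG : s \in <<[set s; t]>> by rewrite mem_gen ?set21.
have tG : t \in <<[set s; t]>> by rewrite mem_gen ?set22.
have /nil_st : <[t]>%G \in [pred H : {group gT} |
    H \subset <<[set s; t]>> :&: [~: H, <<[set s; t]>>]].
  by rewrite inE /= cycle_subG inE tG -{1}tsE mem_commg ?cycle_id.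
by rewrite cycle_eq1 (negPf t_neq1).
Qed.

Lemma nonnil_coordinate (I : finType) (gT : I -> finGroupType)
    (x y : {dffun forall i, gT i}) (i : I) :
  ~~ nilpotent <<[set x i; y i]>> -> ~~ nilpotent <<[set x; y]>>.
Proof.
apply: contra => /(morphim_nil (@dffun_morphism I gT i)).
by rewrite morphim_gen ?subsetT // morphimU !morphim_set1 ?inE.
Qed.

(** The braid relation between two transpositions with one common point: both
    conjugates are the transposition of [x] and [z]. *)
Lemma tperm_braid (T : finType) (x y z : T) : x != y -> y != z -> x != z ->
  tperm y z ^ tperm x y = tperm x y ^ tperm y z.
Proof.
move=> xy yz xz; rewrite !tpermJ !tpermL !tpermR.
by rewrite (@tpermD _ x y z) // (@tpermD _ y z x) // eq_sym.
Qed.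

Definition tau : 'S_3 := tperm (inord 0) (inord 1).
Definition rho : 'S_3 := tau * tperm (inord 1) (inord 2).

Lemma rho_neq1 : rho != 1.
Proof.
apply/eqP=> /permP/(_ (inord 0)).
rewrite !permE /= !permE /= => /(congr1 val).
by rewrite /= -!val_eqE /= !inordK.
Qed.

(** Conjugation by [tau] inverts the 3-cycle [rho], and [rho^-1 = rho ^+ 2]; the
    braid relation gives [rho ^ tau = rho * rho] in one step. *)
Lemma commg_rho_tau : [~ rho, tau] = rho.
Proof.
rewrite commgEl; apply: (mulgI rho); rewrite mulKVg.
rewrite conjMg conjgE mulKg tperm_braid; try by rewrite -val_eqE /= !inordK.
by rewrite conjgE tpermV !mulgA.
Qed.

Lemma tau_rho_nonnil : ~~ nilpotent <<[set tau; rho]>>.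
Proof. exact: commg_fixed_nonnil rho_neq1 commg_rho_tau. Qed.

Section VertexElements.

Variable X : sgraph.

Notation famT := {dffun forall i : X * X, 'S_3}.

Definition vertex_elt (u : X) : famT :=
  [ffun i : X * X => if u == i.1 then tau
                     else if (u == i.2) && adj i.1 i.2 then rho else 1].

Lemma vertex_elt_diag (u v : X) :
  vertex_elt u (v, v) = if u == v then tau else 1.
Proof. by rewrite ffunE /=; case: eqP => // _. Qed.

Lemma vertex_elt_inj : injective vertex_elt.
Proof.
move=> u v /(congr1 (fun x : famT => x (v, v))).
rewrite !vertex_elt_diag eqxx; case: eqP => // _ /esym tau1.
have := commg_rho_tau; rewrite tau1 commg1 => /esym/eqP.
by rewrite (negPf rho_neq1).
Qed.

Lemma vertex_elt_commute (u v : X) :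
  ~~ adj u v -> commute (vertex_elt u) (vertex_elt v).
Proof.
move=> nuv; apply/ffunP=> -[a b]; rewrite !dffunM !ffunE /=.
have nvu : ~~ adj v u by rewrite adj_sym.
have [ua|_] := eqVneq u a; have [va|_] := eqVneq v a; rewrite ?mulg1 ?mul1g //.
- by subst a; have [<-|_] := eqVneq v b; rewrite ?(negPf nuv) ?mulg1 ?mul1g.
- by subst a; have [<-|_] := eqVneq u b; rewrite ?(negPf nvu) ?mulg1 ?mul1g.
by do 2 case: ifP => _; rewrite ?mulg1 ?mul1g.
Qed.

Lemma vertex_elt_nonnil (u v : X) :
  ~~ nilpotent <<[set vertex_elt u; vertex_elt v]>> = adj u v.
Proof.
have [uv|/vertex_elt_commute/commute_nil-> //] := boolP (adj u v).
apply: (@nonnil_coordinate _ _ _ _ (u, v)); rewrite !ffunE /= !eqxx uv.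
have [vu|_] := eqVneq v u; last exact: tau_rho_nonnil.
by rewrite vu adj_irr in uv.
Qed.

Definition vertex_node (u : X) : full_nonnil_graph [set: famT]%G :=
  @Subg _ [set: famT]%G _ (in_setT (vertex_elt u)).

Lemma vertex_node_not_isolated (u : X) : ~~ isolated (vertex_node u).
Proof.
pose y : famT := [ffun=> rho]; apply/forallPn.
exists (@Subg _ [set: famT]%G _ (in_setT y)).
rewrite negbK; apply: (@nonnil_coordinate _ _ _ _ (u, u)) => /=.
by rewrite vertex_elt_diag eqxx ffunE tau_rho_nonnil.
Qed.

End VertexElements.

Theorem theorem5p1 (X : sgraph) :
  exists (gT : finGroupType) (G : {group gT}),
    has_induced_subgraph (nonnil_graph G) X.
Proof.
exists {dffun forall i : X * X, 'S_3}, [set: _]%G.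
have node_in (u : X) : vertex_node u \in [set x | ~~ isolated x].
  by rewrite inE vertex_node_not_isolated.
pose h (u : X) : nonnil_graph [set: {dffun forall i : X * X, 'S_3}]%G :=
  Sub (vertex_node u) (node_in u).
apply: (@has_induced_subgraphI _ _ h) => [u v /(congr1 (sgval \o val))|u v] /=.
  exact: vertex_elt_inj.
exact: vertex_elt_nonnil.
Qed.
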